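(* For every integer $n\ge 3$, the variety $\mathcal N_{n\frac12}$ has an $n\frac12$-near-unanimity term and is not $(2n-4)$-distributive. More generally, the congruence identity $$\alpha(\beta\circ\gamma)\subseteq \alpha\beta\circ(\alpha(\gamma\circ\beta))^{n-3}\circ\alpha\gamma$$ fails in $\mathcal N_{n\frac12}$, that is, there are an algebra in $\mathcal N_{n\frac12}$ and congruences $\alpha,\beta,\gamma$ on it for which this inclusion does not hold.
   Context: **Notation.** For binary relations, juxtaposition denotes intersection and $\circ$ denotes relational composition; so $\alpha(\beta\circ\gamma)=\alpha\cap(\beta\circ\gamma)$. For a reflexive binary relation $R$, $R^k=R\circ R\circ\cdots\circ R$ ($k$ factors), and $R^0$ is the equality relation. In lattices and Boolean algebras, join is $+$, meet is juxtaposition (or $\prod$), and complement is $'$. **$n\frac12$-near-unanimity term.** An $(n+2)$-ary term $u$ such that the following equations hold in the variety: - $u(z,z,x,x,\dots,x)=x$; - $u(x,\dots,x,z,x,\dots,x)=x$ with the single $z$ at position $i$, for every $2\le i\le n+2$; - $u(x,x,x,z,z,\dots,z)=u(x,z,z,z,z,\dots,z)$ (left: $x$ in the first three positions, $z$ elsewhere; right: $x$ in the first position, $z$ elsewhere). **$k$-distributive.** A variety is $k$-distributive if it has ternary terms $t_0,\dots,t_k$ (Jónsson terms) satisfying $t_0(x,y,z)=x$; $t_i(x,y,x)=x$ for $0\le i\le k$; $t_i(x,x,z)=t_{i+1}(x,x,z)$ for even $i$, $0\le i<k$; $t_i(x,z,z)=t_{i+1}(x,z,z)$ for odd $i$, $0\le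 i<k$; $t_k(x,y,z)=z$. **The variety $\mathcal N_{n\frac12}$.** Put $m=n+1$. All algebras below have a single $(n+2)$-ary basic operation (note $n+2=m+1$). - $\mathbf G^{\mathrm{nu},n}$ is the term reduct of the two-element Boolean algebra on $\{0,1\}$ whose only operation is $$u(x_1,\dots,x_{n+2})=(x_1+x_2')\prod_{\substack{1\le i<j\le n+2\\ i\ne 2,\ j\ne 2}}(x_i+x_j).$$ - For $2\le j\le m$, $\mathbf N^{j,m,+}$ is the term reduct of the two-element lattice on $\{0,1\}$ whose only operation is $$u^+_{j,m}(x_1,\dots,x_{m+1})=\prod_{|J|=j}\ \sum_{i\in J}x_i,$$ where $J$ varies over the $j$-element subsets of $\{1,3,4,5,\dots,m,m+1\}$ (the second variable is a dummy variable). - For $n\ge 4$, let $\ell=\frac{m+1}{2}$ if $m$ is odd and $\ell=\frac m2$ if $m$ is even. Then $\mathcal N_{n\frac12}$ is the variety generated by the algebras $\mathbf G^{\mathrm{nu},n},\mathbf N^{3,m,+},\mathbf N^{4,m,+},\dots,\mathbf N^{\ell,m,+}$ (all regarded as algebras of the same type). - For $n=3$, $\mathcal N_{3\frac12}$ is the variety generated by $\mathbf G^{\mathrm{nu},3}$. *)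

(* Defs.v *)
From Stdlib Require Import Relations RelationClasses.
From mathcomp Require Import all_boot.

Set Implicit Arguments.
Unset Strict Implicit.
Unset Printing Implicit Defensive.

(* Algebras with a single N-ary basic operation.  As there are no constants,
   the empty algebra is not excluded; this affects neither which identities
   hold nor the existence of a failure of a congruence inclusion. *)
Record algebra (N : nat) : Type := Algebra {
  carrier :> Type;
  op : ('I_N -> carrier) -> carrier
}.

Arguments op {N} A a : rename.

Definition is_hom (N : nat) (A B : algebra N) (h : A -> B) : Prop :=
  forall a : 'I_N -> A, h (op A a) = op B (fun i => h (a i)).

Definition prod_algebra (N : nat) (I : Type) (A : I -> algebra N) : algebra N :=
  @Algebra N (forall i, A i) (fun a i => op (A i) (fun k => a k i)).

Record is_variety (N : nat) (V : algebra N -> Prop) : Prop := IsVariety {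
  variety_H : forall (A B : algebra N) (h : A -> B),
    is_hom h -> (forall y, exists x, h x = y) -> V A -> V B;
  variety_S : forall (A B : algebra N) (h : B -> A),
    is_hom h -> injective h -> V A -> V B;
  variety_P : forall (I : Type) (A : I -> algebra N),
    (forall i, V (A i)) -> V (prod_algebra A)
}.

Definition generated_variety (N : nat) (K : algebra N -> Prop)
    (A : algebra N) : Prop :=
  forall V : algebra N -> Prop,
    is_variety V -> (forall B, K B -> V B) -> V A.

Inductive term (N k : nat) : Type :=
| Var (i : 'I_k)
| App (args : 'I_N -> term N k).

Fixpoint eval (N k : nat) (A : algebra N) (e : 'I_k -> A) (t : term N k) : A :=
  match t with
  | Var i => e i
  | App args => op A (fun i => eval e (args i))
  end.

(* Positions counted from 1 are shifted: position p is the ordinal p - 1. *)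
Definition half_near_unanimity_term (N n : nat) (V : algebra N -> Prop)
    (u : term N n.+2) : Prop :=
  forall A : algebra N, V A -> forall x z : A,
    [/\ eval (fun k => if k < 2 then z else x) u = x,
        forall i : 'I_n.+2, 1 <= i ->
          eval (fun k => if k == i then z else x) u = x
      & eval (fun k => if k < 3 then x else z) u =
        eval (fun k => if k < 1 then x else z) u].

Definition eval3 (N : nat) (A : algebra N) (t : term N 3) (x y z : A) : A :=
  eval (tnth [tuple x; y; z]) t.

(* Only the terms t 0, ..., t k are constrained. *)
Definition k_distributive (N : nat) (V : algebra N -> Prop) (k : nat) : Prop :=
  exists t : nat -> term N 3, forall A : algebra N, V A ->
    [/\ forall x y z : A, eval3 (t 0) x y z = x,
        forall i, i <= k -> forall x y : A, eval3 (t i) x y x = x,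
        forall i, i < k -> ~~ odd i -> forall x z : A,
          eval3 (t i) x x z = eval3 (t i.+1) x x z,
        forall i, i < k -> odd i -> forall x z : A,
          eval3 (t i) x z z = eval3 (t i.+1) x z z
      & forall x y z : A, eval3 (t k) x y z = z].

Record congruence (N : nat) (A : algebra N) (R : relation A) : Prop :=
  Congruence {
    congruence_equiv : Equivalence R;
    congruence_op : forall a b : 'I_N -> A,
      (forall i, R (a i) (b i)) -> R (op A a) (op A b)
  }.

Definition rcap (T : Type) (R S : relation T) : relation T :=
  fun x y => R x y /\ S x y.

Definition rcomp (T : Type) (R S : relation T) : relation T :=
  fun x y => exists2 w, R x w & S w y.

Definition rpow (T : Type) (R : relation T) (k : nat) : relation T :=
  iter k (rcomp R) eq.

(* u(x_1, ..., x_{n+2}) = (x_1 + x_2') prod_{i < j; i, j <> 2} (x_i + x_j);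
   the second variable has index 1. *)
Definition Gnu (n : nat) : algebra n.+2 :=
  @Algebra n.+2 bool (fun x =>
    (x ord0 || ~~ x (inord 1)) &&
    \big[andb/true]_(i < n.+2)
      \big[andb/true]_(j < n.+2 | [&& i < j, i != 1 :> nat & j != 1 :> nat])
        (x i || x j)).

(* u^+_{j,m}; J ranges over the j-element sets of indices avoiding the
   second variable. *)
Definition Nplus (m j : nat) : algebra m.+1 :=
  @Algebra m.+1 bool (fun x =>
    \big[andb/true]_(J : {set 'I_m.+1} |
        (#|J| == j) && (J \subset [set i : 'I_m.+1 | i != 1 :> nat]))
      \big[orb/false]_(i in J) x i).

Definition ell (m : nat) : nat := if odd m then m.+1./2 else m./2.

Inductive Nhalf_generator (n : nat) : algebra n.+2 -> Prop :=
| Nhalf_generator_G : Nhalf_generator (Gnu n)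
| Nhalf_generator_N (j : nat) :
    4 <= n -> 3 <= j <= ell n.+1 -> Nhalf_generator (Nplus n.+1 j).

Definition Nhalf (n : nat) : algebra n.+2 -> Prop :=
  generated_variety (@Nhalf_generator n).

(* Main.v *)
Require Import Defs.
From Stdlib Require Import Relations RelationClasses FunctionalExtensionality.
From mathcomp Require Import all_boot zify.

(** Write [m = n + 1].  Apart from the second variable, the basic operation of
    every generator is governed by a number [w], its level: the value is [1]
    only if at most [w] of the [m] relevant arguments are [0].  The algebra
    [Gnu n] has level [1], with an extra condition that lowers some values, and
    [Nplus m j] has level [j - 1], with no extra condition.  Exchanging [0] and
    [1] turns level [w] into level [n - w], so that the variety contains the
    plain threshold algebras of every level [2 <= w <= n - 2]
    ([threshold_in_Nhalf]), but only the modified one at level [1].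

    The basic operation itself is the required near-unanimity term: the
    identities involved are checked on the generators by counting zeros, and
    they pass to the generated variety ([generated_variety_identity]).

    For the congruence identity, levels add up under unions of sets of zeros.
    Hence the condition that a plain threshold coordinate of level [v + w] is
    [1] whenever coordinates of levels [v] and [w] both are is preserved by the
    operations; so are inequalities between plain threshold coordinates of
    the same level.  Moreover, three coordinates whose levels
    add up to at most [n] can be forbidden to be [1] together: if the operation
    makes all three equal to [1], then one of the [n + 1] relevant arguments
    has no zero in any of them.  The [ladder] is the subalgebra of a product
    cut out by such conditions: it has coordinates [c_1, ..., c_(n-2)] and
    [d_2, ..., d_(n-2)], indexed by their levels, and [h], [f] of level [1],
    subject to
      [d_w <= c_w],  [h c_w <= d_(w+1)],  [h f c_(n-2) = 0].
    Let [alpha] be equality of [h], let [beta] be equality of [f] and of all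
    [d_w], and let [gamma] be equality of all [c_w].  Start from an element with
    [h = f = 1] and all [c_w], [d_w] equal to [0].  One step along
    [alpha beta] keeps all [c_w] equal to [0]; each further step along
    [alpha (gamma o beta)] can destroy the zero of at most one more [c_w], from
    the top downwards ([ladder_step]).  After [n - 3] such steps [c_1 = 0]
    still, which separates the chain from an element with all [c_w] equal to
    [1].  The nonmonotone algebra of level [1] is harmless here, since [c_1],
    [h] and [f] never occur as conclusions of an implication, so that only the
    upper bound on their numbers of zeros matters.

    Finally, Jonsson terms [t_0, ..., t_(2n-4)], evaluated at [x], [y], [z] with
    [x beta y gamma z] and [x alpha z], would yield just such a chain
    ([k_distributive_inclusion]). *)

Set Implicit Arguments.
Unset Strict Implicit.
Unset Printing Implicit Defensive.

(** * Generated varieties and identities *)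

Lemma generated_variety_is_variety (N : nat) (K : algebra N -> Prop) :
  is_variety (generated_variety K).
Proof.
split.
- move=> A B h hh sh VA V VV KV.
  exact: (variety_H VV hh sh (VA V VV KV)).
- move=> A B h hh ih VA V VV KV.
  exact: (variety_S VV hh ih (VA V VV KV)).
- move=> I A VA V VV KV.
  by apply: (variety_P VV) => i; apply: VA.
Qed.

Lemma generated_variety_generator (N : nat) (K : algebra N -> Prop) A :
  K A -> generated_variety K A.
Proof. by move=> KA V _; apply. Qed.

Lemma generated_variety_embed (N : nat) (K : algebra N -> Prop)
    (A B : algebra N) (h : B -> A) :
  is_hom h -> injective h -> generated_variety K A -> generated_variety K B.
Proof. exact: (variety_S (generated_variety_is_variety K)). Qed.

Lemma eval_hom (N k : nat) (A B : algebra N) (h : A -> B) (e : 'I_k -> A) t :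
  is_hom h -> h (eval e t) = eval (h \o e) t.
Proof.
move=> hh; elim: t => [//|args IH] /=.
by rewrite hh; congr (op B _); apply: functional_extensionality.
Qed.

Definition satisfies (N k : nat) (s t : term N k) (A : algebra N) : Prop :=
  forall e : 'I_k -> A, eval e s = eval e t.

Lemma satisfies_is_variety (N k : nat) (s t : term N k) :
  is_variety (satisfies s t).
Proof.
split.
- move=> A B h hh sh As e.
  have [e' he'] := fin_all_exists (fun i => sh (e i)).
  have -> : e = h \o e' by apply: functional_extensionality => i /=.
  by rewrite -!eval_hom // As.
- move=> A B h hh ih As e.
  by apply: ih; rewrite !eval_hom // As.
- move=> I A As e; apply: functional_extensionality_dep => i.
  have hom_i : @is_hom N (prod_algebra A) (A i) (fun p => p i) by [].
  by rewrite !(eval_hom _ _ hom_i) As.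
Qed.

Lemma generated_variety_identity (N k : nat) (K : algebra N -> Prop)
    (s t : term N k) (A : algebra N) :
  (forall B, K B -> satisfies s t B) -> generated_variety K A ->
  satisfies s t A.
Proof. by move=> Ks; apply; first exact: satisfies_is_variety. Qed.

Definition two_variable_term (N : nat) (p : pred 'I_N) : term N 2 :=
  App (fun i => Var N (if p i then ord_max else ord0)).

Lemma eval_two_variable_term (N : nat) (p : pred 'I_N) (A : algebra N)
    (e : 'I_2 -> A) :
  eval e (two_variable_term p) =
  op A (fun i => if p i then e ord_max else e ord0).
Proof.
by congr (op A _); apply: functional_extensionality => i /=; case: (p i).
Qed.

(** * Congruences and relational chains *)

Lemma joint_kernel_congruence (N : nat) (I : Type) (P : I -> Prop)
    (A : algebra N) (B : I -> algebra N) (h : forall i, A -> B i) :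
  (forall i, is_hom (h i)) ->
  congruence (fun x y : A => forall i, P i -> h i x = h i y).
Proof.
move=> hh; split.
  split.
  - by move=> x i.
  - by move=> x y xy i Pi; rewrite xy.
  - by move=> x y z xy yz i Pi; rewrite xy // yz.
move=> a b ab i Pi; rewrite !hh; congr (op (B i) _).
by apply: functional_extensionality => j; apply: ab.
Qed.

Lemma eval_congruence (N k : nat) (A : algebra N) (R : relation A)
    (e e' : 'I_k -> A) t :
  congruence R -> (forall i, R (e i) (e' i)) -> R (eval e t) (eval e' t).
Proof.
move=> cR ee'; elim: t => [i|args IH] /=; first exact: ee'.
exact: (congruence_op cR).
Qed.

Lemma eval3_congruence (N : nat) (A : algebra N) (R : relation A) t
    (x y z x' y' z' : A) :
  congruence R -> R x x' -> R y y' -> R z z' ->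
  R (eval3 t x y z) (eval3 t x' y' z').
Proof.
move=> cR xx' yy' zz'; apply: eval_congruence => // i.
by rewrite !(tnth_nth x); case: i => [[|[|[|]]]].
Qed.

Lemma rpow_chain (T : Type) (R : relation T) k (f : nat -> T) :
  (forall i, i < k -> R (f i) (f i.+1)) -> rpow R k (f 0) (f k).
Proof.
elim: k f => [//|k IH] f Rf.
exists (f 1); first exact: Rf.
by apply: (IH (fun i => f i.+1)) => i ik; apply: Rf.
Qed.

Lemma rpow_invariant (T : Type) (R : relation T) (P : nat -> T -> Prop) k x y :
  (forall i u v, P i u -> R u v -> P i.+1 v) ->
  P 0 x -> rpow R k x y -> P k y.
Proof.
move=> step; elim: k P step x => [|k IH] P step x P0; first by move=> /= <-.
case=> w Rxw Rwy.
by apply: (IH (fun i => P i.+1) _ w) => //; [move=> i u v; apply: step|apply: step Rxw].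
Qed.

(** With [x alpha z] and [x beta y gamma z], the values [t_i(x,y,z)] all lie in
    the [alpha]-class of [x], since [t_i(x,y,x) = x]; consecutive ones are
    linked alternately by [beta] and [gamma], through [t_i(x,x,z)] and
    [t_i(x,z,z)]. *)
Lemma k_distributive_inclusion (N : nat) (V : algebra N -> Prop) k
    (A : algebra N) (alpha beta gamma : relation A) :
  k_distributive V k.+1.*2 -> V A ->
  congruence alpha -> congruence beta -> congruence gamma ->
  inclusion A
    (rcap alpha (rcomp beta gamma))
    (rcomp (rcap alpha beta)
      (rcomp (rpow (rcap alpha (rcomp gamma beta)) k)
        (rcap alpha gamma))).
Proof.
move=> [t jonsson] VA ca cb cg x z [axz [y bxy gyz]].
have [t0 tid teven todd tk] := jonsson A VA.
have ea := congruence_equiv ca; have eb := congruence_equiv cb.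
have eg := congruence_equiv cg.
pose s i := eval3 (t i) x y z.
have alpha_x i : i <= k.+1.*2 -> alpha (s i) x.
  move=> ik; rewrite -[in X in alpha _ X](tid i ik x y).
  by apply: eval3_congruence => //; [reflexivity..|symmetry].
have alpha_s i j : i <= k.+1.*2 -> j <= k.+1.*2 -> alpha (s i) (s j).
  by move=> ik jk; transitivity x; [|symmetry]; apply: alpha_x.
have beta_s i : i < k.+1.*2 -> ~~ odd i -> beta (s i) (s i.+1).
  move=> ik oi; transitivity (eval3 (t i) x x z).
    by apply: eval3_congruence => //; [reflexivity|symmetry|reflexivity].
  by rewrite teven //; apply: eval3_congruence => //; reflexivity.
have gamma_s i : i < k.+1.*2 -> odd i -> gamma (s i) (s i.+1).
  move=> ik oi; transitivity (eval3 (t i) x z z).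
    by apply: eval3_congruence => //; reflexivity.
  by rewrite todd //; apply: eval3_congruence => //; [reflexivity|symmetry|reflexivity].
exists (s 1).
  by rewrite -[X in rcap _ _ X _](t0 x y z); split; [apply: alpha_s|apply: beta_s].
exists (s k.*2.+1).
  apply: (@rpow_chain _ _ k (fun i => s i.*2.+1)) => i ik; split.
    by apply: alpha_s; lia.
  exists (s i.*2.+2); first by apply: gamma_s; [lia|rewrite /= odd_double].
  by apply: beta_s; [lia|rewrite /= odd_double].
by rewrite -(tk x y z); split; [apply: alpha_s|apply: gamma_s]; rewrite /= ?odd_double; lia.
Qed.

(** * Counting zeros *)

(** Index [1] is the second variable, on which no threshold depends. *)
Definition zeros (n : nat) (x : 'I_n.+2 -> bool) : {set 'I_n.+2} :=
  [set i : 'I_n.+2 | (i != 1 :> nat) && ~~ x i].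

Lemma card_relevant n : #|[set i : 'I_n.+2 | i != 1 :> nat]| = n.+1.
Proof.
have -> : [set i : 'I_n.+2 | i != 1 :> nat] = [set~ inord 1].
  by apply/setP=> i; rewrite !inE -val_eqE /= inordK.
by rewrite cardsC1 card_ord.
Qed.

Lemma card_zeros_negb n (x : 'I_n.+2 -> bool) :
  #|zeros x| + #|zeros (negb \o x)| = n.+1.
Proof.
rewrite -[RHS](card_relevant n) -cardsUI.
have -> : zeros x :&: zeros (negb \o x) = set0.
  by apply/setP=> i; rewrite !inE /=; case: (x i); rewrite ?andbF.
rewrite cards0 addn0; apply: eq_card => i; rewrite !inE /=.
by case: (x i); rewrite /= ?andbT ?andbF ?orbF.
Qed.

Lemma card_zeros_le n (x : 'I_n.+2 -> bool) (s : seq nat) :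
  (forall i : 'I_n.+2, i != 1 :> nat -> ~~ x i -> (i : nat) \in s) ->
  #|zeros x| <= size s.
Proof.
move=> xs; rewrite cardE -(size_map val); apply: uniq_leq_size.
  by rewrite map_inj_uniq ?enum_uniq //; apply: val_inj.
by move=> j /mapP[i]; rewrite mem_enum inE => /andP[i1 xi] ->; apply: xs.
Qed.

Lemma card_zeros_ge n k (x : 'I_n.+2 -> bool) (s : seq nat) :
  k + size s <= n.+1 ->
  (forall i : 'I_n.+2, i != 1 :> nat -> x i -> (i : nat) \in s) ->
  k <= #|zeros x|.
Proof.
move=> ks xs; have ones : #|zeros (negb \o x)| <= size s.
  by apply: card_zeros_le => i i1 /=; rewrite negbK; apply: xs.
by have := card_zeros_negb x; lia.
Qed.

Lemma op_Nplus n j (x : 'I_n.+2 -> bool) :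
  op (Nplus n.+1 j) x = (#|zeros x| < j).
Proof.
rewrite /= big_all_cond; apply/idP/idP.
- apply: contraTT; rewrite -leqNgt => jz.
  have [J JZ Jj] : exists2 J : {set 'I_n.+2}, J \subset zeros x & #|J| = j.
    have : 0 < #|[set J : {set 'I_n.+2} | J \subset zeros x & #|J| == j]|.
      by rewrite cards_draws bin_gt0.
    by case/card_gt0P=> J; rewrite inE => /andP[JZ /eqP]; exists J.
  rewrite -has_predC; apply/hasP; exists J; first by rewrite mem_index_enum.
  rewrite /= Jj eqxx /=.
  have -> : J \subset [set i : 'I_n.+2 | i != 1 :> nat].
    by apply/subsetP=> i /(subsetP JZ); rewrite !inE => /andP[].
  rewrite /= big_has_cond; apply/hasPn=> i _ /=.
  by apply/negP=> /andP[/(subsetP JZ)]; rewrite inE => /andP[_ /negP].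
- move=> zj; apply/allP=> J _; apply/implyP=> /andP[/eqP Jj JS].
  rewrite big_has_cond; apply: contraTT zj => /hasPn J0.
  rewrite -leqNgt -Jj; apply/subset_leq_card/subsetP=> i iJ; rewrite inE.
  have := subsetP JS i iJ; rewrite inE => -> /=.
  by have := J0 i (mem_index_enum i); rewrite /= iJ.
Qed.

Lemma op_Gnu n (x : 'I_n.+2 -> bool) :
  op (Gnu n) x = (x ord0 || ~~ x (inord 1)) && (#|zeros x| <= 1).
Proof.
rewrite /=; congr (_ && _); rewrite big_all_cond leqNgt.
apply/allP/idP => [all2|z1 i _ /=].
- apply/card_gt1P=> -[i [j [+ + ij]]].
  (* the product only runs over ordered pairs of indices *)
  wlog ltij : i j ij / i < j.
    move=> wl iz jz; have [lt|lt|eq] := ltngtP i j.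
    + exact: wl ij lt iz jz.
    + by rewrite eq_sym in ij; exact: wl ij lt jz iz.
    + by rewrite (val_inj eq) eqxx in ij.
  rewrite !inE => /andP[i1 /negbTE xi] /andP[j1 /negbTE xj].
  have := all2 i (mem_index_enum i); rewrite /= big_all_cond => /allP.
  by move=> /(_ j (mem_index_enum j)) /=; rewrite ltij i1 j1 xi xj.
- rewrite big_all_cond; apply/allP=> j _; apply/implyP=> /and3P[ij i1 j1].
  apply: contraNT z1; rewrite negb_or => /andP[xi xj].
  apply/card_gt1P; exists i, j; split; rewrite ?inE ?i1 ?j1 //.
  by apply: contraTneq ij => ->; rewrite ltnn.
Qed.

(** * The near-unanimity term *)

Lemma ell_le n : 4 <= n -> ell n.+1 <= n.-1.
Proof. by rewrite /ell; case: ifP; lia. Qed.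

(** Here [p] marks the arguments [z], and [c] is the only marked position that
    counts for the thresholds, so that there are at most one or at least [n]
    zeros, which decides the value.  When the first argument is marked, the
    second one must be marked as well, or else the factor [x_1 + x_2'] of
    [Gnu n] could vanish: this is why the defining equations of a half
    near-unanimity term single out the first two positions. *)
Lemma generator_one_exception n (B : algebra n.+2) (p : pred 'I_n.+2) (c : nat) :
  3 <= n -> Nhalf_generator B ->
  (forall i : 'I_n.+2, i != 1 :> nat -> p i -> i = c :> nat) ->
  (p ord0 -> p (inord 1)) ->
  forall x z : B, op B (fun i => if p i then z else x) = x.
Proof.
move=> n3 gB pc p01.
have few (z : bool) : #|zeros (fun i => if p i then z else true)| <= 1.
  apply: (@card_zeros_le _ _ [:: c]) => i i1.
  by case: ifP => // pi _; rewrite inE (pc i).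
have many (z : bool) : n <= #|zeros (fun i => if p i then z else false)|.
  apply: (@card_zeros_ge _ _ _ [:: c]) => [|i i1]; first by rewrite addn1.
  by case: ifP => // pi _; rewrite inE (pc i).
case: gB => [|j n4 /andP[j3 jl]] x z.
- rewrite op_Gnu; case: x.
    rewrite few andbT; case: ifP => // /p01 ->.
    by case: z.
  by rewrite [X in _ && X]leqNgt (leq_trans _ (many z)) ?andbF //; lia.
- have jn := leq_trans jl (ell_le n4).
  rewrite op_Nplus; case: x; first by rewrite (leq_ltn_trans (few z)) //; lia.
  by rewrite ltnNge (leq_trans _ (many z)) //; lia.
Qed.

(** Both sides are decided by the number of zeros alone, except in [Gnu n] at
    [x = 0], [z = 1], where the right side has a single counted zero. *)
Lemma generator_half_identity n (B : algebra n.+2) :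
  3 <= n -> Nhalf_generator B ->
  forall x z : B, op B (fun i => if i < 3 then x else z) =
                  op B (fun i => if i < 1 then x else z).
Proof.
move=> n3 gB.
have many3 : n.-1 <= #|zeros (fun i : 'I_n.+2 => if i < 3 then true else false)|.
  apply: (@card_zeros_ge _ _ _ [:: 0; 2]) => [/=|i i1]; first lia.
  by case: ifP => // i2 _; rewrite !inE; lia.
have many1 : n <= #|zeros (fun i : 'I_n.+2 => if i < 1 then true else false)|.
  apply: (@card_zeros_ge _ _ _ [:: 0]) => [|i i1]; first by rewrite addn1.
  by case: ifP => // i2 _; rewrite !inE; lia.
have few3 : #|zeros (fun i : 'I_n.+2 => if i < 3 then false else true)| <= 2.
  apply: (@card_zeros_le _ _ [:: 0; 2]) => i i1.
  by case: ifP => // i2 _; rewrite !inE; lia.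
have few1 : #|zeros (fun i : 'I_n.+2 => if i < 1 then false else true)| <= 1.
  apply: (@card_zeros_le _ _ [:: 0]) => i i1.
  by case: ifP => // i2 _; rewrite !inE; lia.
have two : 1 < #|zeros (fun i : 'I_n.+2 => if i < 3 then false else true)|.
  apply/card_gt1P; exists ord0, (inord 2).
  have n2 : 2 < n.+2 by lia.
  by split; [rewrite inE|rewrite inE inordK|rewrite -val_eqE /= inordK].
have const (b : B) : op B (fun i => if i < 3 then b else b) =
                     op B (fun i => if i < 1 then b else b).
  by congr (op B _); apply: functional_extensionality => i; rewrite !if_same.
case: gB const => [|j n4 /andP[j3 jl]] const [] []; try exact: const.
- have out c : n.-1 <= c -> c <= 1 = false by lia.
  by rewrite !op_Gnu (out _ many3) (out #|_|) ?andbF // (leq_trans _ many1) ?leq_pred.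
-
  (* the left side has two counted zeros, and on the right the factor
     [x_1 + x_2'] vanishes *)
  by rewrite !op_Gnu /= inordK //= leqNgt two.
- have jn := leq_trans jl (ell_le n4).
  have out c : n.-1 <= c -> c < j = false by lia.
  by rewrite !op_Nplus (out _ many3) (out #|_|) // (leq_trans _ many1) ?leq_pred.
- rewrite !op_Nplus (leq_ltn_trans few3) // (leq_ltn_trans few1) //.
  exact: leq_trans j3.
Qed.

Lemma Nhalf_half_near_unanimity n :
  3 <= n -> half_near_unanimity_term (@Nhalf n) (App (@Var n.+2 n.+2)).
Proof.
move=> n3 A VA x z /=.
pose e (i : 'I_2) := if i == ord0 then x else z.
have exception (p : pred 'I_n.+2) (c : nat) :
    (forall i : 'I_n.+2, i != 1 :> nat -> p i -> i = c :> nat) ->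
    (p ord0 -> p (inord 1)) -> op A (fun i => if p i then z else x) = x.
  move=> pc p01.
  have sat : satisfies (two_variable_term p) (Var n.+2 ord0) A.
    apply: generated_variety_identity VA => B gB f.
    by rewrite eval_two_variable_term; apply: generator_one_exception pc p01 _ _.
  by have := sat e; rewrite eval_two_variable_term.
split.
- apply: (exception (fun i => i < 2) 0) => [i|_]; first lia.
  by rewrite inordK.
- move=> i i1; apply: (exception (pred1 i) i) => [j _ /eqP -> //|/=].
  by move=> /eqP i0; rewrite -i0 in i1.
- have sat : satisfies (two_variable_term (fun i : 'I_n.+2 => i < 3))
                       (two_variable_term (fun i : 'I_n.+2 => i < 1)) A.
    apply: generated_variety_identity VA => B gB f.
    by rewrite !eval_two_variable_term; apply: generator_half_identity.
  have := sat (fun i => if i == ord0 then z else x).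
  by rewrite !eval_two_variable_term.
Qed.

(** * Threshold algebras in the variety *)

(** A common form for [Gnu n], at level [1], and for the plain thresholds: as
    all carriers are [bool], elements of a product are boolean functions on the
    set of coordinates. *)
Definition level_algebra (n w : nat) : algebra n.+2 :=
  @Algebra n.+2 bool (fun x =>
    (#|zeros x| <= w) && ((w == 1) ==> (x ord0 || ~~ x (inord 1)))).

(** One of the complementary levels [w] and [n - w] is among those of the
    generators; in the second case negation is the isomorphism, as [x] has at
    most [w] zeros if and only if its negation has more than [n - w]. *)
Lemma threshold_in_Nhalf n w : 2 <= w <= n - 2 -> Nhalf (level_algebra n w).
Proof.
move=> wn.
have Nlevel j : 3 <= j <= ell n.+1 -> Nhalf (Nplus n.+1 j).
  move=> jl; apply: generated_variety_generator.
  by apply: Nhalf_generator_N => //; lia.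
have /negbTE w1 : w != 1 by lia.
have [wl|lw] := leqP w.+1 (ell n.+1).
  have VN : Nhalf (Nplus n.+1 w.+1) by apply: Nlevel; lia.
  apply: (generated_variety_embed (A := Nplus n.+1 w.+1)
    (B := level_algebra n w) (h := id) _ _ VN) => // x.
  by rewrite op_Nplus /= w1 andbT.
have VN : Nhalf (Nplus n.+1 (n.+1 - w)).
  by apply: Nlevel; move: lw; rewrite /ell; case: ifP; lia.
apply: (generated_variety_embed (A := Nplus n.+1 (n.+1 - w))
  (B := level_algebra n w) (h := negb) _ (can_inj negbK) VN) => x.
rewrite op_Nplus /= w1 andbT -ltnNge; move: (card_zeros_negb x).
by rewrite /comp; move: #|_| #|_| => a b; lia.
Qed.

Lemma level_algebra_in_Nhalf n w :
  0 < w -> (w == 1) || (w <= n - 2) -> Nhalf (level_algebra n w).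
Proof.
have [->|w1] := eqVneq w 1 => w0 wn; last by apply: threshold_in_Nhalf; lia.
have VG := generated_variety_generator (Nhalf_generator_G n).
apply: (generated_variety_embed (A := Gnu n)
  (B := level_algebra n 1) (h := id) _ _ VG) => // x.
by rewrite op_Gnu andbC.
Qed.

(** * The separating algebra *)

(** With [n = k + 3], the coordinate [C w] is [c_(w+1)] and [D w] is [d_(w+2)];
    this shift makes both families start at index [0]. *)
Inductive coord (k : nat) : Type := C (w : 'I_k.+1) | D (w : 'I_k) | H | F.

Arguments H {k}.
Arguments F {k}.

Definition level k (c : coord k) : nat :=
  match c with C w => w.+1 | D w => w.+2 | _ => 1 end.

Definition ladder_cond k (p : coord k -> bool) : bool :=
  [forall w : 'I_k, (p (D w) ==> p (C (lift ord0 w))) &&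
                    (p H && p (C (widen_ord (leqnSn k) w)) ==> p (D w))] &&
  ~~ [&& p H, p F & p (C ord_max)].

Definition coord_op k (a : 'I_k.+3.+2 -> coord k -> bool) (c : coord k) : bool :=
  op (level_algebra k.+3 (level c)) (fun i => a i c).

Lemma coord_op_zeros k (a : 'I_k.+3.+2 -> coord k -> bool) c :
  coord_op a c -> #|zeros (fun i => a i c)| <= level c.
Proof. by case/andP. Qed.

Lemma coord_op_D k (a : 'I_k.+3.+2 -> coord k -> bool) w :
  coord_op a (D w) = (#|zeros (fun i => a i (D w))| <= w.+2).
Proof. by rewrite /coord_op /= andbT. Qed.

(** In each case the zeros of one coordinate lie among those of the others, and
    the levels add up accordingly. *)
Lemma ladder_cond_closed k (a : 'I_k.+3.+2 -> {p : coord k -> bool | ladder_cond p}) :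
  ladder_cond (coord_op (fun i => sval (a i))).
Proof.
have cond i : ladder_cond (sval (a i)) := svalP (a i).
set b := fun i => sval (a i).
have DC i w : b i (D w) -> b i (C (lift ord0 w)).
  by have /andP[/forallP/(_ w)/andP[/implyP]] := cond i.
have CD i w : b i H -> b i (C (widen_ord (leqnSn k) w)) -> b i (D w).
  move=> bH bC; have /andP[/forallP/(_ w)/andP[_ /implyP]] := cond i.
  by rewrite -/(b i) bH bC => ->.
have HFC i : ~~ [&& b i H, b i F & b i (C ord_max)].
  by have /andP[] := cond i.
apply/andP; split.
  apply/forallP=> w; apply/andP; split; apply/implyP.
  - rewrite coord_op_D => Dw; rewrite /coord_op /= andbT.
    apply: leq_trans Dw; apply/subset_leq_card/subsetP=> i.
    by rewrite !inE => /andP[-> /=]; apply: contra; apply: DC.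
  - move=> /andP[/coord_op_zeros zH /coord_op_zeros zC]; rewrite coord_op_D.
    apply: leq_trans (leq_add zH zC).
    apply: leq_trans (leq_card_setU _ _).
    apply/subset_leq_card/subsetP=> i; rewrite !inE => /andP[-> /=].
    by rewrite -negb_and; apply: contra => /andP[]; apply: CD.
apply/negP=> /and3P[/coord_op_zeros zH /coord_op_zeros zF /coord_op_zeros zC].
have : k.+3.+1 <= 1 + (1 + k.+1).
  rewrite -[X in X <= _](card_relevant k.+3).
  apply: leq_trans (leq_add zH (leq_add zF zC)).
  apply: leq_trans (leq_add (leqnn _) (leq_card_setU _ _)).
  apply: leq_trans (leq_card_setU _ _).
  apply/subset_leq_card/subsetP=> i; rewrite !inE => -> /=.
  by rewrite -!negb_and; apply: HFC.
by rewrite !add1n ltnn.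
Qed.

Definition ladder (k : nat) : algebra k.+3.+2 :=
  @Algebra k.+3.+2 {p : coord k -> bool | ladder_cond p}
    (fun a => exist (fun p => ladder_cond p) _ (ladder_cond_closed a)).

Lemma ladder_in_Nhalf k : Nhalf (ladder k).
Proof.
have prodV : Nhalf (prod_algebra (fun c : coord k => level_algebra k.+3 (level c))).
  apply: (variety_P (generated_variety_is_variety _)) => c.
  by apply: level_algebra_in_Nhalf; case: c => [w|w||] //=; have := ltn_ord w; lia.
have sval_hom : @is_hom _ (ladder k) (prod_algebra
    (fun c : coord k => level_algebra k.+3 (level c))) sval by [].
by apply: (generated_variety_embed sval_hom) prodV; apply: val_inj.
Qed.

Definition coord_kernel k (P : coord k -> Prop) : relation (ladder k) :=
  fun p q => forall c, P c -> sval p c = sval q c.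

Lemma coord_kernel_congruence k (P : coord k -> Prop) :
  congruence (coord_kernel P).
Proof.
exact: (@joint_kernel_congruence _ _ P (ladder k)
  (fun c => level_algebra k.+3 (level c)) (fun c p => sval p c)).
Qed.

Definition alpha k : relation (ladder k) :=
  coord_kernel (fun c => if c is H then True else False).

Definition beta k : relation (ladder k) :=
  coord_kernel (fun c => match c with D _ | F => True | _ => False end).

Definition gamma k : relation (ladder k) :=
  coord_kernel (fun c => if c is C _ then True else False).

(** What is left of the initial zeros after [i] steps. *)
Definition zeros_below k (i : nat) (p : ladder k) : Prop :=
  sval p H /\ forall w : 'I_k.+1, w + i <= k -> ~~ sval p (C w).

(** The [gamma]-part of the step preserves the zeros of all [c_w] and hence
    forces [d_w = 0] at the same levels; the [beta]-part preserves these, and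
    [h = 1] then forces [c_w = 0] one level below. *)
Lemma ladder_step k i (p q : ladder k) :
  zeros_below i p -> rcap (@alpha k) (rcomp (@gamma k) (@beta k)) p q ->
  zeros_below i.+1 q.
Proof.
move=> [pH pC] [pqH [r prC rqD]].
have qH : sval q H by rewrite -(pqH H).
split=> // w wi; have wk : w < k by lia.
have Dq : ~~ sval q (D (Ordinal wk)).
  rewrite -(rqD (D _)) //; have /andP[/forallP/(_ (Ordinal wk))/andP[+ _] _] := svalP r.
  move=> /implyP DC; apply/negP=> /DC; apply/negP; rewrite -(prC (C _)) //.
  by apply: pC; rewrite /= /bump; lia.
have /andP[/forallP/(_ (Ordinal wk))/andP[_ +] _] := svalP q.
have -> : widen_ord (leqnSn k) (Ordinal wk) = w by apply: val_inj.
by rewrite qH /= (negbTE Dq) implybF.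
Qed.

Lemma ladder_start_cond k :
  ladder_cond (fun c : coord k => if c is (H | F) then true else false).
Proof. by rewrite /ladder_cond /= andbT; apply/forallP. Qed.

Lemma ladder_middle_cond k :
  ladder_cond (fun c : coord k => if c is (C _ | F) then true else false).
Proof. by rewrite /ladder_cond /= andbT; apply/forallP. Qed.

Lemma ladder_end_cond k :
  ladder_cond (fun c : coord k => if c is F then false else true).
Proof. by rewrite /ladder_cond /= andbT; apply/forallP. Qed.

Lemma ladder_inclusion_fails k :
  ~ inclusion (ladder k)
      (rcap (@alpha k) (rcomp (@beta k) (@gamma k)))
      (rcomp (rcap (@alpha k) (@beta k))
        (rcomp (rpow (rcap (@alpha k) (rcomp (@gamma k) (@beta k))) k)
          (rcap (@alpha k) (@gamma k)))).
Proof.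
pose x : ladder k := exist (fun p => ladder_cond p) _ (ladder_start_cond k).
pose y : ladder k := exist (fun p => ladder_cond p) _ (ladder_middle_cond k).
pose z : ladder k := exist (fun p => ladder_cond p) _ (ladder_end_cond k).
move=> /(_ x z) [].
  by split; [case|exists y; case].
move=> p [xpH xpDF] [q pq [_ qzC]].
have pH : sval p H by rewrite -(xpH H).
have /andP[/forallP cond pHFC] := svalP p.
(* the top zero comes from the condition on [h], [f], [c_(n-2)], the others
   from [d_w = 0] *)
have p0 : zeros_below 0 p.
  split=> // w _; have [wk|kw] := ltnP w k.
    have /andP[_] := cond (Ordinal wk).
    have -> : widen_ord (leqnSn k) (Ordinal wk) = w by apply: val_inj.
    by rewrite -(xpDF (D _)) // pH; case: (sval p (C w)).
  have -> : w = ord_max by apply: val_inj => /=; have := ltn_ord w; lia.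
  by move: pHFC; rewrite -(xpDF F) // pH.
have [_ /(_ ord0)] := rpow_invariant (@ladder_step k) p0 pq.
by rewrite (qzC (C _)) // => /(_ (leqnn _)).
Qed.

Theorem theorem4p5 (n : nat) (hn : 3 <= n) :
  ((exists u : term n.+2 n.+2, half_near_unanimity_term (@Nhalf n) u) /\
   ~ k_distributive (@Nhalf n) (2 * n - 4)) /\
  (exists A : algebra n.+2, Nhalf A /\
    exists alpha beta gamma : relation A,
      [/\ congruence alpha, congruence beta, congruence gamma
        & ~ inclusion A
              (rcap alpha (rcomp beta gamma))
              (rcomp (rcap alpha beta)
                (rcomp (rpow (rcap alpha (rcomp gamma beta)) (n - 3))
                  (rcap alpha gamma)))]).
Proof.
have NU := Nhalf_half_near_unanimity hn.
have [k nk] : exists k, n = k.+3 by exists (n - 3); lia.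
subst n.
have -> : 2 * k.+3 - 4 = k.+1.*2 by lia.
have -> : k.+3 - 3 = k by lia.
split; last first.
  exists (ladder k); split; first exact: ladder_in_Nhalf.
  exists (@alpha k), (@beta k), (@gamma k).
  by split; try exact: coord_kernel_congruence; apply: ladder_inclusion_fails.
split; first by exists (App (@Var k.+3.+2 k.+3.+2)).
move=> kd; apply: (@ladder_inclusion_fails k).
exact: (k_distributive_inclusion kd (@ladder_in_Nhalf k)
  (coord_kernel_congruence _) (coord_kernel_congruence _)
  (coord_kernel_congruence _)).
Qed.
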